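(* Let $\mathcal{W}=\{\mathbb{R}^d; f_1,\dots,f_N; p_1,\dots,p_N\}$ be a weighted IFS, $N\ge2$, with all $p_i>0$, $\sum_i p_i=1$, such that each $f_i$ satisfies $s_i\|x-y\|\le\|f_i(x)-f_i(y)\|\le c_i\|x-y\|$ for all $x,y\in\mathbb{R}^d$, where $0<s_i\le c_i<1$ (no separation condition is assumed). Let $\mu$ be its invariant Borel probability measure, let $r\in(0,\infty)$, and let $l_r\in(0,\infty)$ be the unique number with $\sum_{i=1}^N(p_ic_i^r)^{\frac{l_r}{r+l_r}}=1$. Then $$\limsup_{n\to\infty} n\cdot e_{n,r}(\mu)^{l_r}<\infty,$$ and consequently $\overline{D}_r(\mu)\le l_r$.
   Context: $\|\cdot\|$ is the Euclidean norm. The invariant measure of the weighted IFS is the unique Borel probability measure $\mu$ with $\mu=\sum_{i=1}^N p_i\,\mu\circ f_i^{-1}$. For a Borel probability measure $\mu$ on $\mathbb{R}^d$, $r>0$, $n\in\mathbb{N}$: $V_{n,r}(\mu)=\inf\{\int\operatorname{dist}(x,B)^r d\mu(x): B\subset\mathbb{R}^d,\ \operatorname{card}(B)\le n\}$, $e_{n,r}(\mu)=V_{n,r}(\mu)^{1/r}$, and $\overline{D}_r(\mu)=\limsup_{n\to\infty}\frac{\log n}{-\log e_{n,r}(\mu)}$. *)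

(* Defs.v *)
From HB Require Import structures.
From mathcomp Require Import all_boot all_order all_algebra.
From mathcomp Require Import all_classical all_reals all_analysis.
Set Implicit Arguments. Unset Strict Implicit. Unset Printing Implicit Defensive.
Import Order.TTheory GRing.Theory Num.Theory.
Import numFieldNormedType.Exports.
Local Open Scope classical_set_scope.
Local Open Scope ring_scope.

Definition Rd (R : realType) (d : nat) : measurableType _ :=
  g_sigma_algebraType (@open 'rV[R]_d).

Definition enorm (R : realType) (d : nat) (x : 'rV[R]_d) : R :=
  Num.sqrt (\sum_(i < d) x ord0 i ^+ 2).

Definition distB (R : realType) (d : nat) (x : 'rV[R]_d) (B : seq 'rV[R]_d) : R :=
  \big[Num.min/enorm (x - head 0 B)]_(b <- B) enorm (x - b).

(* n-th quantization error V_{n,r}(mu): infimum over sets B with 1 <= card B <= n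
   (the empty set gives dist = +oo and does not contribute). *)
Definition Vnr (R : realType) (d : nat) (mu : probability (Rd R d) R)
  (n : nat) (r : R) : \bar R :=
  ereal_inf [set (\int[mu]_x ((distB (x : 'rV[R]_d) B) `^ r)%:E)%E
            | B in [set B : seq 'rV[R]_d | (0 < size B <= n)%N]].

Definition enr (R : realType) (d : nat) (mu : probability (Rd R d) R)
  (n : nat) (r : R) : \bar R := poweR (Vnr mu n r) r^-1.

Definition upper_qdim (R : realType) (d : nat) (mu : probability (Rd R d) R)
  (r : R) : \bar R :=
  limn_esup (fun n : nat => ((ln (n%:R : R)) / (- ln (fine (enr mu n r))))%:E).

(* Main.v *)
(* Put [t i := (p i * c i ^ r) ^ (l / (r + l))], so that [\sum_i t i = 1] and
   [p i * c i ^ r = t i * t i ^ (r / l)].  A set [B] with error at most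
   [M * e ^ (r / l)] and at most [1 / (e * tau)] points, where [tau := min_i t i],
   is built by recursion on the scale [e]: one point suffices for [e >= 1], since
   [mu] has bounded support; for [e < 1], take the union of the images [f i (B i)],
   where [B i] is built for the scale [e / t i].  Cardinalities and errors both add
   up to the right value because [\sum_i t i = 1].  Taking [e := 1 / (n * tau)]
   gives [e_{n,r} <= D * n ^ (- 1 / l)].  The recursion replaces the usual
   antichain of words. *)
Require Import Defs.
From HB Require Import structures.
From mathcomp Require Import all_boot all_order all_algebra.
From mathcomp Require Import ring lra.
From mathcomp Require Import all_classical all_reals all_analysis.
From mathcomp Require Import measurable_realfun.
Import Order.TTheory GRing.Theory Num.Theory.
Import numFieldNormedType.Exports.
Local Open Scope classical_set_scope.
Local Open Scope ring_scope.

(** * The Euclidean norm *)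

Lemma enorm_ge0 {R : realType} {d : nat} (x : 'rV[R]_d) : 0 <= enorm x.
Proof. exact: sqrtr_ge0. Qed.

Lemma sqr_enorm {R : realType} {d : nat} (x : 'rV[R]_d) :
  enorm x ^+ 2 = \sum_(i < d) x ord0 i ^+ 2.
Proof. by rewrite sqr_sqrtr// sumr_ge0// => i _; exact: sqr_ge0. Qed.

Lemma enorm0 {R : realType} {d : nat} : enorm (0 : 'rV[R]_d) = 0.
Proof.
by rewrite /enorm big1 ?sqrtr0// => i _; rewrite mxE expr0n.
Qed.

Lemma enormN {R : realType} {d : nat} (x : 'rV[R]_d) : enorm (- x) = enorm x.
Proof. by rewrite /enorm; under eq_bigr do rewrite mxE sqrrN. Qed.

Lemma coord_le_enorm {R : realType} {d : nat} (x : 'rV[R]_d) (i : 'I_d) :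
  `|x ord0 i| <= enorm x.
Proof.
rewrite -sqrtr_sqr ler_wsqrtr// (bigD1 i)//= lerDl.
by apply: sumr_ge0 => j _; exact: sqr_ge0.
Qed.

Lemma enorm_eq0 {R : realType} {d : nat} (x : 'rV[R]_d) : enorm x = 0 -> x = 0.
Proof.
move=> x0; apply/rowP => i; rewrite mxE; apply/eqP.
by rewrite -normr_le0 -x0 coord_le_enorm.
Qed.

(** Instead of Cauchy-Schwarz, [(a + b) ^+ 2] is split with the weights [1 + b / a] and [1 + a / b],
    for which the inequality already holds in each coordinate. The weights divide by the norms, so
    zero vectors are treated first. *)
Lemma enormD {R : realType} {d : nat} (x y : 'rV[R]_d) :
  enorm (x + y) <= enorm x + enorm y.
Proof.
have [/enorm_eq0 ->|x0] := eqVneq (enorm x) 0; first by rewrite add0r enorm0 add0r.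
have [/enorm_eq0 ->|y0] := eqVneq (enorm y) 0; first by rewrite addr0 enorm0 addr0.
have {}x0 : 0 < enorm x by rewrite lt_def x0 enorm_ge0.
have {}y0 : 0 < enorm y by rewrite lt_def y0 enorm_ge0.
set a := enorm x; set b := enorm y.
rewrite -(@ler_pXn2r _ 2)// ?nnegrE ?addr_ge0 ?enorm_ge0//.
have -> : (a + b) ^+ 2 = (1 + b / a) * a ^+ 2 + (1 + a / b) * b ^+ 2.
  by field; rewrite !gt_eqF.
rewrite !sqr_enorm !mulr_sumr -big_split/= ler_sum// => i _; rewrite mxE.
(* AM-GM: [2 u v <= (b / a) u^2 + (a / b) v^2] *)
rewrite -subr_ge0; set u := x _ _; set v := y _ _.
rewrite (_ : _ - _ = (b * u - a * v) ^+ 2 / (a * b)); last first.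
  by field; rewrite !gt_eqF.
by rewrite divr_ge0 ?sqr_ge0// mulr_ge0// ltW.
Qed.

(** * Continuity and measurability of norms, maps and distances *)

Lemma continuous_enormB {R : realType} {d : nat} (b : 'rV[R]_d) :
  continuous (fun x : 'rV[R]_d => enorm (x - b)).
Proof.
suff sc : continuous (fun x : 'rV[R]_d => \sum_(i < d) (x - b) ord0 i ^+ 2).
  move=> x; apply: (@continuous_comp _ _ _ _ Num.sqrt); first exact: sc.
  exact: sqrt_continuous.
apply: continuous_big; first exact: add_continuous.
move=> i _ x.
apply: (@continuous_comp _ _ _ (fun z : 'rV[R]_d => (z - b) ord0 i)
  (fun t => t ^+ 2)); last exact: exprn_continuous.
rewrite (_ : (fun z : 'rV[R]_d => _) = (fun z => z ord0 i - b ord0 i)); last first.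
  by apply/funext => z; rewrite !mxE.
apply: (@continuousB _ _ _ (fun z : 'rV[R]_d => z ord0 i) (cst (b ord0 i))).
  exact: coord_continuous.
exact: cst_continuous.
Qed.

Lemma measurable_continuous_Rd {R : realType} {d : nat} (g : Rd R d -> R) :
  continuous (g : 'rV[R]_d -> R) -> measurable_fun setT g.
Proof.
move=> gc; apply: (measurability _ (RGenOpens.measurableE R)).
move=> _ [_ [a [b ->] <-]].
rewrite setTI; apply: sub_sigma_algebra.
by apply: open_comp => // x _; exact: gc.
Qed.

(** Balls of row vectors are coordinatewise, while the hypothesis is Euclidean: each coordinate is
    bounded by [enorm], and [enorm (y - x)] is small near [x] by continuity. *)
Lemma continuous_enorm_lipschitz {R : realType} {d : nat}
    {g : 'rV[R]_d -> 'rV[R]_d} {k : R} :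
  (forall x y, enorm (g x - g y) <= k * enorm (x - y)) -> continuous g.
Proof.
move=> gk x A /nbhs_ballP[e e0 eA].
suff : \forall y \near x, ball (g x) e (g y).
  by apply: filterS => y; exact: eA.
have kc : continuous (fun y : 'rV[R]_d => k * enorm (y - x)).
  move=> y; apply: (@continuousM _ 'rV[R]_d (cst k) (fun y => enorm (y - x))).
    exact: cst_continuous.
  exact: continuous_enormB.
move: (kc x).
rewrite /continuous_at subrr enorm0 mulr0 => /cvgrPdist_lt/(_ e e0) H.
near=> y; split => // i j; rewrite (ord1 i) -ball_normE/=.
have : `|0 - k * enorm (y - x)| < e by near: y; exact: H.
rewrite sub0r normrN; apply: le_lt_trans.
have := coord_le_enorm (g x - g y) j; rewrite !mxE => /le_trans; apply.
by rewrite -enormN opprB (le_trans (gk _ _))// ler_norm.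
Unshelve. all: by end_near. Qed.

Lemma measurable_continuous_RdRd {R : realType} {d : nat}
    (g : 'rV[R]_d -> 'rV[R]_d) :
  continuous g -> measurable_fun setT (g : Rd R d -> Rd R d).
Proof.
move=> gc.
apply: (@measurability _ _ (Rd R d) (Rd R d) setT g (@open 'rV[R]_d)) => //.
move=> _ [U oU <-]; rewrite setTI; apply: sub_sigma_algebra.
by apply: open_comp => // x _; exact: gc.
Qed.

Lemma distB_le {R : realType} {d : nat} (x b : 'rV[R]_d) (B : seq 'rV[R]_d) :
  b \in B -> distB x B <= enorm (x - b).
Proof. by move=> bB; exact: ge_bigmin_seq. Qed.

Lemma le_distB {R : realType} {d : nat} (a : R) (x : 'rV[R]_d)
    (B : seq 'rV[R]_d) :
  (0 < size B)%N -> (forall b, b \in B -> a <= enorm (x - b)) -> a <= distB x B.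
Proof.
move=> B0 aB; rewrite /distB big_seq; apply: le_bigmin => //.
(* The starting value of the minimum is the distance to the head of [B], which is a genuine point
   since [B] is nonempty. *)
by apply: aB; case: B B0 => //= b B _; rewrite mem_head.
Qed.

Lemma measurable_distB {R : realType} {d : nat} (B : seq 'rV[R]_d) :
  measurable_fun setT (fun x : Rd R d => distB (x : 'rV[R]_d) B).
Proof.
(* The starting point is generalized so that it stays fixed during the induction on [B]. *)
rewrite /distB; move: (head 0 B) => b0.
have mB (b : 'rV[R]_d) : measurable_fun setT (fun x : Rd R d => enorm (x - b)).
  by apply: measurable_continuous_Rd; exact: continuous_enormB.
elim: B => [|b B IH]; first by under eq_fun do rewrite big_nil; exact: mB.
under eq_fun do rewrite big_cons.
exact: (measurable_minr (mB b) IH).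
Qed.

Lemma measurable_distB_powR {R : realType} {d : nat} (B : seq 'rV[R]_d) (r : R) :
  measurable_fun setT (fun x : Rd R d => (distB (x : 'rV[R]_d) B `^ r)%:E).
Proof.
apply/measurable_EFinP.
by apply: (measurableT_comp (measurable_powR r)); exact: measurable_distB.
Qed.

(** * Invariance of integrals and bounded support *)

(** On measurable sets [mu] agrees with a finite sum of scaled pushforwards, and integration is
    additive and homogeneous in the measure. *)
Lemma ge0_integral_self_similar {R : realType} {d : measure_display}
    {T : measurableType d} {N : nat} {f : 'I_N -> T -> T} {p : 'I_N -> R}
    {mu : probability T R} {g : T -> \bar R} :
  (forall i, 0 < p i) -> (forall i, measurable_fun setT (f i)) ->
  (forall A, measurable A -> mu A = (\sum_(i < N) (p i)%:E * mu (f i @^-1` A))%E) ->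
  measurable_fun setT g -> (forall x, 0 <= g x)%E ->
  (\int[mu]_x g x = \sum_(i < N) (p i)%:E * \int[mu]_x g (f i x))%E.
Proof.
move=> p0 mf muE mg g0.
(* An empty system would give total mass 0. A successor is wanted because finite sums of measures
   are indexed by naturals, converted below with [inord]. *)
case: N f p p0 mf muE => [|N] f p p0 mf muE.
  have := muE setT measurableT; rewrite big_ord0 probability_setT => /eqP.
  by rewrite eqe oner_eq0.
have push i : {nu : measure T R | nu = pushforward mu (f i) :> (set T -> \bar R)}.
  by unshelve eexists (pushforward mu (f i)); first exact: mf.
pose m (n : nat) : measure T R :=
  mscale (NngNum (ltW (p0 (inord n)))) (sval (push (inord n))).
rewrite (@eq_measure_integral _ _ _ _ (msum m N.+1)); last first.
  move=> A mA _; rewrite [LHS](muE _ mA) /msum/=; apply: eq_bigr => i _.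
  rewrite /m /mscale/= inord_val; congr (_ * _)%E.
  exact: (esym (congr1 (@^~ A) (svalP (push i)))).
rewrite ge0_integral_measure_sum//; apply: eq_bigr => i _.
rewrite /m ge0_integral_mscale//= inord_val; congr (_ * _)%E.
rewrite -[RHS](@ge0_integral_pushforward _ _ _ _ _ (f i) (mf i) mu setT g)//.
by apply: eq_measure_integral => A _ _; exact: (congr1 (@^~ A) (svalP (push i))).
Qed.

Lemma ex_max_ord {R : realDomainType} {N : nat} (F : 'I_N -> R) :
  (0 < N)%N -> exists j, forall i, F i <= F j.
Proof.
move=> N0; case: (@Order.TotalTheory.arg_maxP _ _ _ (Ordinal N0) xpredT F) => //= j _ Fj.
by exists j => i; exact: Fj.
Qed.

Lemma measurable_enorm_le {R : realType} {d : nat} (a : R) :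
  measurable [set x : Rd R d | enorm (x : 'rV[R]_d) <= a].
Proof.
have m : measurable_fun setT (fun x : Rd R d => enorm (x - 0 : 'rV[R]_d)).
  by apply: measurable_continuous_Rd; exact: continuous_enormB.
have := m measurableT _ (measurable_itv `]-oo, a]); rewrite setTI.
by congr measurable; apply/seteqP; split=> x; rewrite /= in_itv/= subr0.
Qed.

(** By invariance, shrinking the radius [q + a] to [q + k0 * a] loses no mass. Iterating, the ball
    of radius [q + 1] has at least the mass of any ball, and balls exhaust the space. *)
Lemma self_similar_bounded_support {R : realType} {d N : nat}
    {f : 'I_N -> 'rV[R]_d -> 'rV[R]_d} {p c : 'I_N -> R}
    {mu : probability (Rd R d) R} :
  (0 < N)%N -> (forall i, 0 < p i) -> \sum_(i < N) p i = 1 ->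
  (forall i, 0 <= c i < 1) ->
  (forall i x y, enorm (f i x - f i y) <= c i * enorm (x - y)) ->
  (forall A : set (Rd R d), measurable A ->
     mu A = (\sum_(i < N) (p i)%:E * mu (f i @^-1` A))%E) ->
  exists2 rho : R, 0 < rho &
    mu [set x : Rd R d | enorm (x : 'rV[R]_d) <= rho] = 1%E.
Proof.
move=> N0 p0 p1 c01 fc muE.
pose E a := [set x : Rd R d | enorm (x : 'rV[R]_d) <= a].
have mE a : measurable (E a) by exact: measurable_enorm_le.
have [j cj] := ex_max_ord c N0; have [k fk] := ex_max_ord (fun i => enorm (f i 0)) N0.
set k0 := c j in cj; set b := enorm (f k 0) in fk.
have /andP[k0ge0 k0lt1] : 0 <= k0 < 1 by exact: c01.
pose q := b / (1 - k0).
have q0 : 0 <= q by rewrite divr_ge0 ?enorm_ge0// subr_ge0 ltW.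
have qE : k0 * q + b = q by rewrite /q; field; rewrite gt_eqF// subr_gt0.
(* [q] is the fixed point of [a |-> k0 * a + b], and each [f i] maps the ball
   of radius [a] into the ball of radius [k0 * a + b]. *)
have contract a : 0 <= a -> (mu (E (q + a)%R) <= mu (E (q + k0 * a)%R))%E.
  (* Both sides become sums weighted by [p i]; the terms compare because [E (q + a)] lies in each
     preimage of [E (q + k0 * a)]. *)
  move=> a0; rewrite [leRHS]muE// -[leLHS]mul1e -p1 -sumEFin ge0_sume_distrl; last first.
    by move=> i _; rewrite lee_fin ltW.
  apply: lee_sum => i _; apply: lee_wpmul2l; first by rewrite lee_fin ltW.
  apply: le_measure; rewrite ?inE//.
    have := measurable_continuous_RdRd _ (continuous_enorm_lipschitz (fc i)).
    by move=> /(_ measurableT _ (mE (q + k0 * a))); rewrite setTI.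
  move=> x; rewrite /E/= => xa.
  rewrite -[f i x](subrK (f i 0)) (le_trans (enormD _ _))//.
  rewrite (@le_trans _ _ (k0 * (q + a) + b))//; last by rewrite mulrDr addrAC qE.
  rewrite lerD// (le_trans (fc _ _ _))// subr0.
  by rewrite ler_pM ?enorm_ge0//; case/andP: (c01 i).
have iter n a : 0 <= a -> (mu (E (q + a)%R) <= mu (E (q + k0 ^+ n * a)%R))%E.
  move=> a0; elim: n => [|n IH]; first by rewrite expr0 mul1r.
  rewrite (le_trans IH)// exprS -mulrA; apply: contract.
  by rewrite mulr_ge0// exprn_ge0.
exists (q + 1); first by rewrite ltr_wpDl.
have sub a a' : a <= a' -> (mu (E a) <= mu (E a'))%E.
  by move=> aa'; apply: le_measure; rewrite ?inE// => x /le_trans; apply.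
have full n : (mu (E n%:R) <= mu (E (q + 1)%R))%E.
  apply: (@le_trans _ _ (mu (E (q + n%:R)))); first by apply: sub; rewrite lerDr.
  (* This tolerance yields an [m] with [k0 ^+ m * n%:R <= 1]. *)
  have /cvgrPdist_le/(_ (n%:R + 1)^-1) : (GRing.exp k0 : R ^nat) @ \oo --> 0.
    by apply: cvg_expr; rewrite ger0_norm.
  move=> /(_ _)[|m _ /(_ m (leqnn m))]/=; first by rewrite invr_gt0 ltr_wpDl.
  rewrite sub0r normrN => km.
  apply: le_trans (iter m _ (ler0n _ n)) _; apply: sub.
  rewrite lerD2l; move: km; rewrite ger0_norm ?exprn_ge0// => km.
  have n1 : 0 < n%:R + 1 :> R by rewrite ltr_wpDl.
  rewrite (@le_trans _ _ ((n%:R + 1)^-1 * (n%:R + 1)))//; last first.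
    by rewrite mulVf// gt_eqF.
  by rewrite ler_pM// ?exprn_ge0// lerDl.
apply/le_anti/andP; split; first by apply: probability_le1; exact: mE.
have cvgE : mu (E n%:R) @[n --> \oo] --> mu (\bigcup_n E n%:R).
  apply: nondecreasing_cvg_mu => //; first exact: bigcup_measurable.
  move=> m n mn; apply/subsetPset => x /le_trans; apply.
  by rewrite ler_nat.
have <- : mu (\bigcup_n E n%:R) = 1%E.
  rewrite -(probability_setT mu); congr (mu _); apply/seteqP; split=> // x _.
  exists (Num.truncn (enorm (x : 'rV[R]_d))).+1 => //.
  by rewrite /E/= ltW// truncnS_gt.
rewrite -(cvg_lim _ cvgE)//; apply: lime_le; first by apply/cvg_ex; eexists; exact: cvgE.
exact: nearW.
Qed.

(** * Construction of quantizing sets *)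

Lemma distB_ge0 {R : realType} {d : nat} (x : 'rV[R]_d) (B : seq 'rV[R]_d) :
  0 <= distB x B.
Proof.
by rewrite /distB; apply: le_bigmin => [|b _]; exact: enorm_ge0.
Qed.

Lemma distB_lipschitz {R : realType} {d : nat} (g : 'rV[R]_d -> 'rV[R]_d) (k : R)
    (B C : seq 'rV[R]_d) (x : 'rV[R]_d) :
  0 < k -> (forall x y, enorm (g x - g y) <= k * enorm (x - y)) ->
  (0 < size B)%N -> (forall b, b \in B -> g b \in C) ->
  distB (g x) C <= k * distB x B.
Proof.
move=> k0 gk B0 BC; rewrite mulrC -ler_pdivrMr//; apply: le_distB => // b /BC gbC.
by rewrite ler_pdivrMr// mulrC (le_trans (distB_le _ _ _ gbC)).
Qed.

(** Start of the recursion: almost every point is within [rho] of the origin. This supplies the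
    constant [M]. *)
Lemma integral_distB_seq1 {R : realType} {d : nat} {mu : probability (Rd R d) R}
    {r rho : R} :
  0 < r -> mu [set x : Rd R d | enorm (x : 'rV[R]_d) <= rho] = 1%E ->
  (\int[mu]_x (distB (x : 'rV[R]_d) [:: 0] `^ r)%:E <= (rho `^ r)%:E)%E.
Proof.
move=> r0; set E := [set x : Rd R d | _] => muE1.
have mE : measurable E by exact: measurable_enorm_le.
have muEC : mu (~` E) = 0%E by rewrite probability_setC// [X in (_ - X)%E]muE1 subee.
rewrite (ge0_negligible_integral (measurableC mE))//; last 2 first.
  exact: measurable_distB_powR.
  by move=> x _; rewrite lee_fin powR_ge0.
rewrite setDE setCK setTI.
apply: (@le_trans _ _ (\int[mu]_(x in E) (rho `^ r)%:E)%E).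
  apply: ge0_le_integral => //.
  - by move=> x _; rewrite lee_fin powR_ge0.
  - by apply: (measurable_funS measurableT) => //; exact: measurable_distB_powR.
  - move=> x Ex; rewrite lee_fin ge0_ler_powR ?nnegrE ?distB_ge0 ?(ltW r0)//.
      exact: le_trans (enorm_ge0 (x : 'rV[R]_d)) Ex.
    by rewrite (le_trans (distB_le _ 0 _ _)) ?mem_head ?subr0.
by rewrite integral_cst// [X in (_ * X)%E]muE1 mule1.
Qed.

(** One step of the recursion: invariance splits the integral over the maps, and in the [i]-th term
    the points [f i b] with [b] in [B i] already give the factor [c i ^ r]. *)
Lemma integral_distB_flatten {R : realType} {d N : nat}
    {f : 'I_N -> 'rV[R]_d -> 'rV[R]_d} {p c : 'I_N -> R}
    {mu : probability (Rd R d) R} {r : R} (B : 'I_N -> seq 'rV[R]_d) :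
  0 < r -> (forall i, 0 < p i) -> (forall i, 0 < c i) ->
  (forall i x y, enorm (f i x - f i y) <= c i * enorm (x - y)) ->
  (forall A : set (Rd R d), measurable A ->
     mu A = (\sum_(i < N) (p i)%:E * mu (f i @^-1` A))%E) ->
  (forall i, (0 < size (B i))%N) ->
  (\int[mu]_x (distB (x : 'rV[R]_d)
                (flatten [seq [seq f i b | b <- B i] | i <- enum 'I_N]) `^ r)%:E
   <= \sum_(i < N) (p i * c i `^ r)%:E *
        \int[mu]_x (distB (x : 'rV[R]_d) (B i) `^ r)%:E)%E.
Proof.
move=> r0 p0 c0 fc muE B0; set C := flatten _.
have fBC i b : b \in B i -> f i b \in C.
  move=> bB; apply/flattenP; exists [seq f i b | b <- B i]; last exact: map_f.
  by apply/mapP; exists i => //; rewrite mem_enum.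
have mf i : measurable_fun setT (f i : Rd R d -> Rd R d).
  exact: measurable_continuous_RdRd _ (continuous_enorm_lipschitz (fc i)).
rewrite (ge0_integral_self_similar p0 mf muE) /=; last 2 first.
  exact: measurable_distB_powR.
  by move=> x; rewrite lee_fin powR_ge0.
apply: lee_sum => i _; rewrite EFinM -muleA; apply: lee_wpmul2l.
  by rewrite lee_fin ltW.
rewrite -ge0_integralZl_EFin ?powR_ge0//; last 2 first.
  by move=> x _; rewrite lee_fin powR_ge0.
  exact: measurable_distB_powR.
apply: ge0_le_integral => //.
- by move=> x _; rewrite lee_fin powR_ge0.
- exact: (measurableT_comp (measurable_distB_powR C r) (mf i)).
- by apply: emeasurable_funM => //; exact: measurable_distB_powR.
- move=> x _; rewrite -EFinM lee_fin -powRM ?distB_ge0 ?(ltW (c0 i))//.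
  rewrite ge0_ler_powR ?nnegrE ?distB_ge0 ?(ltW r0)//.
    by rewrite mulr_ge0 ?distB_ge0 ?(ltW (c0 i)).
  exact: distB_lipschitz (B0 i) (fBC i).
Qed.

Lemma ex_quantizer {R : realType} {d N : nat}
    {f : 'I_N -> 'rV[R]_d -> 'rV[R]_d} {p c t : 'I_N -> R}
    {mu : probability (Rd R d) R} {r l M tau : R} :
  (0 < N)%N -> 0 < r -> 0 < l -> 0 <= M -> 0 < tau ->
  (forall i, 0 < p i) -> (forall i, 0 < c i) ->
  (forall i x y, enorm (f i x - f i y) <= c i * enorm (x - y)) ->
  (forall A : set (Rd R d), measurable A ->
     mu A = (\sum_(i < N) (p i)%:E * mu (f i @^-1` A))%E) ->
  (\int[mu]_x (distB (x : 'rV[R]_d) [:: 0] `^ r)%:E <= M%:E)%E ->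
  (forall i, tau <= t i < 1) -> \sum_(i < N) t i = 1 ->
  (forall i, p i * c i `^ r = t i * t i `^ (r / l)) ->
  forall eps : R, 0 < eps -> eps * tau <= 1 ->
  exists B : seq 'rV[R]_d, [/\ (0 < size B)%N, (size B)%:R * (eps * tau) <= 1 &
    (\int[mu]_x (distB (x : 'rV[R]_d) B `^ r)%:E <= (M * eps `^ (r / l))%:E)%E].
Proof.
move=> N0 r0 l0 M0 tau0 p0 c0 fc muE int0 tau_t t1 pct eps eps0.
have t0 i : 0 < t i by case/andP: (tau_t i) => /(lt_le_trans tau0).
(* The real scale is controlled by a natural number [k] with [theta ^+ k <= eps]. Passing from [e]
   to [e / t i] divides by at most [theta], so [k] drops by one. *)
have [j tj] := ex_max_ord t N0; set theta := t j in tj.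
have [k] : exists k : nat, theta ^+ k <= eps.
  have /cvgrPdist_le/(_ _ eps0)[k _ /(_ k (leqnn k))/=] :
      (GRing.exp theta : R ^nat) @ \oo --> 0.
    by apply: cvg_expr; rewrite ger0_norm ?(ltW (t0 j))//; case/andP: (tau_t j).
  rewrite sub0r normrN => km; exists k.
  by rewrite (le_trans (ler_norm _)).
have rl0 : 0 <= r / l by rewrite divr_ge0 ?ltW.
(* Serves both for [k = 0] and for scales [e >= 1] met earlier; [e * tau <= 1] is what allows one
   point. *)
have base e : 1 <= e -> e * tau <= 1 -> exists B : seq 'rV[R]_d,
    [/\ (0 < size B)%N, (size B)%:R * (e * tau) <= 1 &
    (\int[mu]_x (distB (x : 'rV[R]_d) B `^ r)%:E <= (M * e `^ (r / l))%:E)%E].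
  move=> e1 etau; exists [:: 0]; split=> //; first by rewrite mul1r.
  apply: (le_trans int0); rewrite lee_fin ler_peMr//.
  by rewrite -(powRr0 e) ler_powR.
elim: k eps eps0 => [|k IH] e e0 ke etau; first by apply: base; rewrite // expr0 in ke.
have [e1|e1] := leP 1 e; first exact: base.
have {}IH i : exists B : seq 'rV[R]_d,
    [/\ (0 < size B)%N, (size B)%:R * (e / t i * tau) <= 1 &
    (\int[mu]_x (distB (x : 'rV[R]_d) B `^ r)%:E
       <= (M * (e / t i) `^ (r / l))%:E)%E].
  apply: IH; first by rewrite divr_gt0.
    rewrite ler_pdivlMr// (le_trans _ ke)// exprSr ler_wpM2l// exprn_ge0//.
    exact: ltW (t0 j).
  (* The side condition survives the step: [e < 1] and [tau <= t i] give [e * tau <= t i]. *)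
  rewrite mulrAC ler_pdivrMr// mul1r (@le_trans _ _ tau)//.
    by rewrite ler_piMl// ltW.
  by case/andP: (tau_t i).
have [B BP] := choice IH.
have B0 i : (0 < size (B i))%N by case: (BP i).
exists (flatten [seq [seq f i b | b <- B i] | i <- enum 'I_N]).
have sizeE : size (flatten [seq [seq f i b | b <- B i] | i <- enum 'I_N]) =
    (\sum_(i < N) size (B i))%N.
  rewrite size_flatten /shape -map_comp sumnE big_map big_enum/=.
  by apply: eq_bigr => i _; rewrite size_map.
split.
- by rewrite sizeE (bigD1 (Ordinal N0))//= addn_gt0 B0.
- rewrite sizeE natr_sum mulr_suml -[leRHS]t1 ler_sum// => i _.
  have [_ + _] := BP i.
  (* The [i]-th piece uses at most the share [t i] of the allowed number of points. *)
  rewrite (_ : _ * _ = (size (B i))%:R * (e * tau) / t i); last by ring.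
  by rewrite ler_pdivrMr// mul1r.
- apply: le_trans (integral_distB_flatten B r0 p0 c0 fc muE B0) _.
  rewrite -[M * _]mulr1 -t1 mulr_sumr -sumEFin; apply: lee_sum => i _.
  have [_ _ intB] := BP i.
  apply: le_trans (lee_wpmul2l _ intB) _.
    by rewrite lee_fin mulr_ge0 ?powR_ge0 ?(ltW (p0 i)).
  rewrite -EFinM lee_fin pct.
  (* The powers of [t i] cancel, leaving the share [t i] of the allowed error. *)
  rewrite (_ : t i * _ * _ = M * (t i `^ (r / l) * (e / t i) `^ (r / l)) * t i); last by ring.
  rewrite -powRM ?(ltW (t0 i)) ?divr_ge0 ?(ltW e0) ?(ltW (t0 i))//.
  by rewrite (_ : t i * (e / t i) = e)//; field; rewrite gt_eqF.
Qed.

(** * From error bounds to the two asymptotic statements *)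

Lemma limn_esup_le {R : realType} (u : (\bar R)^nat) (a : \bar R) (m : nat) :
  (forall n, (m <= n)%N -> (u n <= a)%E) -> (limn_esup u <= a)%E.
Proof.
move=> ua; apply: (@le_trans _ _ (ereal_sup (u @` [set n | (m <= n)%N]))).
  by apply: ereal_inf_lbound; exists [set n | (m <= n)%N] => //; exists m.
by apply: ge_ereal_sup => _ [n mn <-]; exact: ua.
Qed.

Lemma Vnr_ge0 {R : realType} {d : nat} (mu : probability (Rd R d) R)
  (n : nat) (r : R) : (0 <= Vnr mu n r)%E.
Proof.
apply: le_ereal_inf_tmp => _ [B _ <-]; apply: integral_ge0 => x _.
by rewrite lee_fin powR_ge0.
Qed.

Lemma enr_le {R : realType} {d : nat} {mu : probability (Rd R d) R}
    {n : nat} {r l M e : R} (B : seq 'rV[R]_d) :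
  0 < r -> 0 <= M -> (0 < size B <= n)%N ->
  (\int[mu]_x (distB (x : 'rV[R]_d) B `^ r)%:E <= (M * e `^ (r / l))%:E)%E ->
  (enr mu n r <= (M `^ r^-1 * e `^ l^-1)%:E)%E.
Proof.
move=> r0 M0 Bn intB.
have VM : (Vnr mu n r <= (M * e `^ (r / l))%:E)%E.
  by apply: le_trans intB; apply: ereal_inf_lbound; exists B.
rewrite (_ : M `^ _ * _ = (M * e `^ (r / l)) `^ r^-1); last first.
  rewrite powRM ?powR_ge0// -powRrM; congr (_ * _ `^ _).
  by rewrite mulrAC divff ?mul1r// gt_eqF.
rewrite -poweR_EFin /enr; apply: gt0_ler_poweR => //.
- by rewrite invr_ge0 ltW.
- by rewrite in_itv/= Vnr_ge0 leey.
- by rewrite in_itv/= lee_fin leey andbT mulr_ge0 ?powR_ge0.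
Qed.

(** The powers of [n] cancel, leaving the bound [D ^ l / tau] for all [n >= 1]. *)
Lemma limn_esup_enr_lty {R : realType} {d : nat} {mu : probability (Rd R d) R}
    {r l D tau : R} :
  0 < l -> 0 <= D -> 0 < tau ->
  (forall n, (0 < n)%N -> (enr mu n r <= (D * (n%:R * tau)^-1 `^ l^-1)%:E)%E) ->
  (limn_esup (fun n : nat => (n%:R)%:E * poweR (enr mu n r) l) < +oo)%E.
Proof.
move=> l0 D0 tau0 enrD.
apply: (@le_lt_trans _ _ (D `^ l / tau)%:E); last exact: ltry.
apply: (@limn_esup_le _ _ _ 1%N) => n n0.
apply: (@le_trans _ _ (n%:R%:E * poweR (D * (n%:R * tau)^-1 `^ l^-1)%:E l)%E).
  apply: lee_wpmul2l; first by rewrite lee_fin.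
  apply: gt0_ler_poweR; [exact: ltW| | |exact: enrD].
  - by rewrite in_itv/= poweR_ge0 leey.
  - by rewrite in_itv/= lee_fin leey andbT mulr_ge0 ?powR_ge0.
have n0R : 0 < n%:R :> R by rewrite ltr0n.
rewrite poweR_EFin -EFinM lee_fin powRM ?powR_ge0// -powRrM mulVf ?gt_eqF//.
rewrite powRr1 ?invr_ge0 ?mulr_ge0 ?(ltW tau0)//.
by rewrite le_eqVlt; apply/orP; left; apply/eqP; field; rewrite !gt_eqF.
Qed.

(** Logarithms turn the hypothesis into [ln n - K <= l * - ln a], so the quotient is at most
    [l * ln n / (ln n - K)] for large [n], which tends to [l]. *)
Lemma upper_qdim_le {R : realType} {d : nat} {mu : probability (Rd R d) R}
    {r l D tau : R} :
  0 < l -> 0 < D -> 0 < tau ->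
  (forall n, (0 < n)%N -> (enr mu n r <= (D * (n%:R * tau)^-1 `^ l^-1)%:E)%E) ->
  (upper_qdim mu r <= l%:E)%E.
Proof.
move=> l0 D0 tau0 enrD; apply/lee_addgt0Pr => delta delta0.
pose K := l * ln D - ln tau; pose K1 := Num.max K 0 + 1.
have KK1 : K < K1 by rewrite ltr_pwDr// le_max lexx.
have K10 : 0 < K1 by rewrite ltr_wpDl// le_max lexx orbT.
(* Solves [delta * T = (l + delta) * K1]: from [ln n >= T] on, the slack [delta] absorbs [K].
   Positivity of [K1] makes [ln n > K1 > K]. *)
pose T := (l + delta) / delta * K1.
apply: (@limn_esup_le _ _ _ (Num.truncn (expR T)).+1) => n Tn.
have n0 : (0 < n)%N by exact: leq_trans Tn.
have n0R : 0 < n%:R :> R by rewrite ltr0n.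
have Tlnn : T <= ln n%:R.
  rewrite -(expRK T) ler_ln ?posrE ?expR_gt0//.
  by rewrite (le_trans (ltW (truncnS_gt _)))// ler_nat.
rewrite -EFinD lee_fin; set a := fine _.
have a0 : 0 <= a by rewrite fine_ge0// poweR_ge0.
have aD : a <= D * (n%:R * tau)^-1 `^ l^-1.
  rewrite -lee_fin fineK; first exact: enrD.
  by rewrite ge0_fin_numE ?poweR_ge0// (le_lt_trans (enrD _ n0)) ?ltry.
(* For zero error the conventions [ln 0 = 0] and [0^-1 = 0] make the quotient 0. *)
move: a0; rewrite le_eqVlt => /predU1P[<-|a0].
  by rewrite (ln0 (lexx 0)) oppr0 invr0 mulr0 addr_ge0 ?ltW.
have lna : ln n%:R - K <= l * - ln a.
  have : ln a <= ln (D * (n%:R * tau)^-1 `^ l^-1).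
    by rewrite ler_ln ?posrE// mulr_gt0 ?powR_gt0 ?invr_gt0 ?mulr_gt0.
  rewrite lnM ?posrE ?powR_gt0 ?invr_gt0 ?mulr_gt0// ln_powR.
  rewrite lnV ?posrE ?mulr_gt0// lnM ?posrE// -(ler_pM2l l0).
  rewrite (_ : l * (_ + _) = l * ln D - ln n%:R - ln tau); last first.
    by field; rewrite gt_eqF.
  by rewrite /K; lra.
have TE : delta * T = (l + delta) * K1 by rewrite /T; field; rewrite gt_eqF.
have dT : (l + delta) * K1 <= delta * ln n%:R by rewrite -TE ler_pM2l.
have lK1 : 0 < l * K1 by rewrite mulr_gt0.
have K1n : K1 < ln n%:R.
  by rewrite -(ltr_pM2l delta0) (lt_le_trans _ dT)// mulrDl ltrDr.
have lna0 : 0 < - ln a.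
  by rewrite -(pmulr_rgt0 _ l0) (lt_le_trans _ lna)// subr_gt0 (lt_trans KK1).
rewrite ler_pdivrMr// -(ler_pM2l l0) mulrCA.
apply: (@le_trans _ _ ((l + delta) * (ln n%:R - K))); last first.
  by rewrite ler_pM2l// addr_gt0.
rewrite mulrBr lerBrDr [leRHS]mulrDl lerD2l (le_trans _ dT)//.
by rewrite ler_pM2l ?addr_gt0// ltW.
Qed.

(** * The weights [t i] and the choice of scale *)

Theorem theorem4 (R : realType) (d N : nat) (f : 'I_N -> 'rV[R]_d -> 'rV[R]_d)
  (p s c : 'I_N -> R) (mu : probability (Rd R d) R) (r l : R) :
  (2 <= N)%N ->
  (forall i, 0 < p i) ->
  \sum_(i < N) p i = 1 ->
  (forall i, 0 < s i /\ s i <= c i /\ c i < 1) ->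
  (forall i x y, s i * enorm (x - y) <= enorm (f i x - f i y) /\
                 enorm (f i x - f i y) <= c i * enorm (x - y)) ->
  (forall A : set (Rd R d), measurable A ->
     mu A = (\sum_(i < N) (p i)%:E * mu (f i @^-1` A))%E) ->
  0 < r -> 0 < l ->
  \sum_(i < N) (p i * c i `^ r) `^ (l / (r + l)) = 1 ->
  (limn_esup (fun n : nat => (n%:R)%:E * poweR (enr mu n r) l) < +oo)%E /\
  (upper_qdim mu r <= l%:E)%E.
Proof.
move=> N2 p0 p1 sc fsc muE r0 l0; set t := fun i => (p i * c i `^ r) `^ (l / (r + l)).
move=> t1.
have N0 : (0 < N)%N by exact: ltnW.
have c0 i : 0 < c i by have [s0 [sci _]] := sc i; exact: lt_le_trans sci.
have c01 i : 0 <= c i < 1 by rewrite ltW//=; case: (sc i) => _ [].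
have fc i x y : enorm (f i x - f i y) <= c i * enorm (x - y) by case: (fsc i x y).
have pc0 i : 0 < p i * c i `^ r by rewrite mulr_gt0// powR_gt0.
have t0 i : 0 < t i by exact: powR_gt0.
(* Maximizing [- t i] gives the smallest weight [t j], which plays the role of [tau]. *)
have [j tj] := ex_max_ord (fun i => - t i) N0.
(* Since [N >= 2], another positive weight takes part in the sum 1. *)
have t_lt1 i : t i < 1.
  have [k ki] : exists k : 'I_N, k != i.
    case: (eqVneq (Ordinal N0) i) => [<-|]; last by exists (Ordinal N0).
    by exists (Ordinal N2).
  rewrite -t1 (bigD1 i)//= (bigD1 k)//= ltrDl ltr_pwDl//; first exact: t0.
  by rewrite sumr_ge0// => h _; exact: ltW (t0 h).
have pct i : p i * c i `^ r = t i * t i `^ (r / l).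
  rewrite -{1}(powRr1 (ltW (t0 i))) -powRD; last by rewrite (gt_eqF (t0 i)) implybT.
  rewrite /t -powRrM (_ : l / (r + l) * (1 + r / l) = 1).
    by rewrite powRr1// ltW.
  by field; rewrite !gt_eqF ?addr_gt0.
have [rho rho0 murho] := self_similar_bounded_support N0 p0 p1 c01 fc muE.
have M0 : 0 < rho `^ r by exact: powR_gt0.
have int0 := integral_distB_seq1 r0 murho.
have tau_t i : t j <= t i < 1 by rewrite t_lt1 andbT -lerN2.
have enrD n : (0 < n)%N ->
    (enr mu n r <= ((rho `^ r) `^ r^-1 * (n%:R * t j)^-1 `^ l^-1)%:E)%E.
  move=> n0; have n0R : 0 < n%:R :> R by rewrite ltr0n.
  (* At this scale the cardinality bound of the quantizer reads exactly [size B <= n]. *)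
  have nt : (n%:R * t j)^-1 * t j = n%:R^-1.
    by field; rewrite !gt_eqF.
  have [||B [B0 + intB]] := ex_quantizer N0 r0 l0 (ltW M0) (t0 j) p0 c0 fc muE int0
    tau_t t1 pct (n%:R * t j)^-1.
  - by rewrite invr_gt0 mulr_gt0.
  - by rewrite nt invf_le1// ler1n.
  rewrite nt ler_pdivrMr// mul1r ler_nat => Bn.
  by apply: (enr_le B) intB; rewrite ?B0 ?(ltW M0).
have D0 : 0 < (rho `^ r) `^ r^-1 by exact: powR_gt0.
split; [exact: limn_esup_enr_lty l0 (ltW D0) (t0 j) enrD|
        exact: upper_qdim_le l0 D0 (t0 j) enrD].
Qed.
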